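(* Let $p\geq 2$ be an integer and let $G=\Theta_{p,p,p}$ or $G=\Theta_{p,p,p+2}$. Then $\mathrm{dim}(G)=2c(G)-1$.
   Context: All graphs are finite, simple and connected. For positive integers $p\le q\le r$ (with $q\ge 2$, so that the graph is simple), $\Theta_{p,q,r}$ denotes the graph consisting of two distinct vertices $u,v$ joined by three internally vertex-disjoint paths of lengths (numbers of edges) $p$, $q$ and $r$. For vertices $x,y$ of a graph $G$, $d(x,y)$ is the length of a shortest path between them. A vertex $s$ distinguishes two vertices $x,x'$ if $d(s,x)\neq d(s,x')$. A set $S\subseteq V(G)$ is a vertex metric generator if every pair of distinct vertices of $G$ is distinguished by some $s\in S$. The vertex metric dimension $\mathrm{dim}(G)$ is the size of a smallest vertex metric generator of $G$. The cyclomatic number of $G$ is $c(G)=|E(G)|-|V(G)|+1$. *)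

(* Defs.v *)
From mathcomp Require Import all_boot all_order all_algebra.
Set Implicit Arguments.
Unset Strict Implicit.
Unset Printing Implicit Defensive.

Record sgraph := SGraph {
  vertex :> finType;
  adj : rel vertex;
  adj_sym : symmetric adj;
  adj_irrefl : irreflexive adj }.

Definition isomorphic (G H : sgraph) : Prop :=
  exists2 f : G -> H, bijective f & forall x y, adj (f x) (f y) = adj x y.

Section Invariants.
Variable G : sgraph.

Definition edges : {set {set G}} :=
  [set [set xy.1; xy.2] | xy : G * G & adj xy.1 xy.2].

(* A path with n edges has n + 1 <= #|G| distinct vertices, so n < #|G|
   loses nothing; #|G| is a junk value, reached only when x and y lie in
   different components. *)
Definition dist (x y : G) : nat :=
  \big[minn/#|G|]_(n < #|G| |
    [exists s : n.-tuple G,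
      [&& path (@adj G) x s, last x s == y & uniq (x :: s)]]) n.

Definition distinguishes (s x y : G) : bool := dist s x != dist s y.

Definition vertex_metric_generator (S : {set G}) : bool :=
  [forall x, forall y, (x != y) ==> [exists s in S, distinguishes s x y]].

(* The default value #|G| is the size of [set: G], which is always a
   generator, so it never affects the minimum. *)
Definition metric_dim : nat :=
  \big[minn/#|G|]_(S : {set G} | vertex_metric_generator S) #|S|.

Definition cyclomatic : int := (#|edges|%:Z - #|G|%:Z + 1)%R.

End Invariants.

Section Theta.
Variables p q r : nat.

Definition theta_length (i : 'I_3) : nat := tnth [tuple p; q; r] i.

(* inl false is u, inl true is v; inr holds the internal vertices of the
   three paths. *)
Definition theta_vertex : finType :=
  (bool + {i : 'I_3 & 'I_(theta_length i).-1})%type.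

(* The vertex at position k of the i-th path, which runs from u (position 0)
   to v (position theta_length i); position k strictly between the two is
   the internal vertex with ordinal k - 1. *)
Definition theta_pos (i : 'I_3) (k : nat) : theta_vertex :=
  if k is k'.+1 then
    if insub k' is Some j
    then inr (existT (fun i => 'I_(theta_length i).-1) i j)
    else inl true
  else inl false.

Definition theta_adj (x y : theta_vertex) : bool :=
  [exists i : 'I_3, exists k : 'I_(theta_length i),
    ((x == theta_pos i k) && (y == theta_pos i k.+1))
    || ((y == theta_pos i k) && (x == theta_pos i k.+1))].

Lemma theta_adj_sym : symmetric theta_adj.
Proof.
move=> x y; apply: eq_existsb => i; apply: eq_existsb => k.
by rewrite orbC.
Qed.

Lemma theta_pos_neq i k :
  k < theta_length i -> theta_pos i k != theta_pos i k.+1.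
Proof.
case: k => [|k] lt_k; apply/eqP => /=; first by case: insubP.
have lt_k1 : k < (theta_length i).-1 by rewrite -ltnS (ltn_predK lt_k).
rewrite (insubT (fun m => m < _) lt_k1); case: insubP => [j' _ jk'|] //.
move/(congr1 (fun x : theta_vertex =>
  if x is inr u then nat_of_ord (tagged u) else 0)) => /= E.
by move: jk'; rewrite /= -E => /n_Sn.
Qed.

Lemma theta_adj_irrefl : irreflexive theta_adj.
Proof.
move=> x; apply/negbTE/negP => /existsP[i /existsP[k]].
rewrite orbb.
by case/andP => /eqP -> /idPn[]; apply: theta_pos_neq.
Qed.

(* Intended for 1 <= p <= q <= r and 2 <= q; two paths of length 1 would be
   merged into a single edge. *)
Definition Theta : sgraph := SGraph theta_adj_sym theta_adj_irrefl.

End Theta.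

(* Main.v *)
Require Import Defs.
From mathcomp Require Import all_boot all_order all_algebra.
From mathcomp Require Import zify.
Set Implicit Arguments.
Unset Strict Implicit.
Unset Printing Implicit Defensive.

(** Write $r$ for the length of the third path, so that $r = p$ or $r = p + 2$.
    The graph has $2p + r - 1$ vertices and $2p + r$ edges, so its cyclomatic
    number is $2$, and the claim is that its metric dimension is $3$.

    A vertex is located by a path and a position on it.  With the end $v$
    placed on one of the two paths of length $p$, the distance between two
    vertices is $|k - l|$ when they have positions $k$ and $l$ on the same path,
    and otherwise the length of the shorter way round the cycle formed by their
    two paths ([theta_distE]).  No shortest path needs a detour through a third
    path, because the lengths differ by at most $2$.  Everything else becomes
    linear arithmetic on positions.

    Upper bound: the vertex $u$ together with its neighbours on the two paths
    of length $p$ is a generator.  The distance to $u$ gives the position on the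
    path (up to confusing $v$ with position $p$ of the third path when
    $r = p + 2$), and the two neighbours tell which path it is
    ([pos_dist_separates]).

    Lower bound: for any two vertices $s$ and $t$ there are two distinct
    vertices that neither of them distinguishes ([pos_dist_twins]), so no set of
    size at most $2$ is a generator.  If $r = p$ and $s$ and $t$ lie inside the
    same path, the neighbours of $u$ on the two other paths will do.  If $s$ and
    $t$ lie inside different paths, at positions $k$ and $l$, one looks for two
    vertices such that $s$ reaches one of them through $u$ and the other through
    $v$, or one of them along its own path and the other through $u$ or $v$, and
    similarly for $t$.  Equating the lengths gives a linear system, whose
    solution has admissible positions in a region given by the order of $k$ and
    $l$ and the size of $k + l$; finitely many such regions cover all cases.

    Both sides of the equality are invariant under isomorphism
    ([metric_dim_iso], [cyclomatic_iso]). *)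

(** * Arithmetic of positions *)

(** The length of path number [i], for paths of lengths [p], [p] and [r]. *)
Definition path_len (p r i : nat) : nat := if i == 2 then r else p.

(** The distance from position [k] of path [i] to position [l] of path [j]:
    along the common path, or else the shorter way round the cycle formed by the
    two paths.  For [r = p] and [r = p + 2] this is the distance in the graph as
    soon as [canonical p r i k] holds.  Without that condition it fails, when
    [r = p + 2], between the two ends of the third path, which are at distance
    [p] and not [p + 2]. *)
Definition pos_dist (p r i k j l : nat) : nat :=
  if i == j then (k - l) + (l - k)
  else minn (k + l) ((path_len p r i + path_len p r j) - (k + l)).

(** Positions that represent every vertex exactly once: the ends of the paths
    count as positions of path 0 only. *)
Definition canonical (p r i k : nat) : bool :=
  [&& i < 3, k <= path_len p r i & (i == 0) || (0 < k < path_len p r i)].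

(** Two positions denote the same vertex when they coincide or when both are
    the common start, or the common end, of their paths. *)
Definition same_pos (p r i k j l : nat) : bool :=
  [|| (i == j) && (k == l), (k == 0) && (l == 0) |
      (k == path_len p r i) && (l == path_len p r j)].

(** There are two distinct vertices that neither of the two given ones
    distinguishes. *)
Definition have_twins (p r i k j l : nat) : Prop :=
  exists a m b n,
    [/\ [&& a < 3, m <= path_len p r a, b < 3 & n <= path_len p r b],
        ~~ same_pos p r a m b n,
        pos_dist p r i k a m = pos_dist p r i k b n &
        pos_dist p r j l a m = pos_dist p r j l b n].

Lemma pos_dist_twin_eq (p i k j l : nat) :
  2 <= p -> canonical p p i k -> canonical p p j l ->
  have_twins p p i k j l.
Proof.
rewrite /have_twins /canonical /same_pos /pos_dist.
have lenE c : path_len p p c = p by rewrite /path_len; case: ifP.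
rewrite !lenE => hp /and3P[hi hk hik] /and3P[hj hl hjl].
have [hij|/negbTE hij] := eqVneq i j.
  subst j.
  have [a [b [ha hb [hia hib hab]]]] :
      exists a b, [/\ a < 3, b < 3 &
        [/\ (i == a) = false, (i == b) = false & (a == b) = false]].
    case: (i) hi => [|[|[|//]]] _.
    - by exists 1, 2.
    - by exists 0, 2.
    - by exists 0, 1.
  by exists a, 1, b, 1; rewrite !lenE !(hia, hib, hab); split; lia.
(* the remaining path *)
have [c [hc hic hjc]] :
    exists c, [/\ c < 3, (i == c) = false & (j == c) = false].
  by exists (3 - (i + j)); split; lia.
have hji : (j == i) = false by rewrite eq_sym.
pose E := (eqxx, hij, hji, hic, hjc, lenE).
(* An end of the paths lies on every path, so it can be moved to the path of
   the other vertex, which leaves two paths free of both. *)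
have [hk0|hk0] := boolP ((k == 0) || (k == p)).
  by exists i, 1, c, 1; rewrite !E; split; lia.
have [hl0|hl0] := boolP ((l == 0) || (l == p)).
  by exists j, 1, c, 1; rewrite !E; split; lia.
have [hkl|hkl] := leqP k l; have [hs|hs] := leqP p (k + l).
- by exists j, (l - k), c, (2 * p - (k + l)); rewrite !E; split; lia.
- by exists i, (p + k - l), c, (p - (k + l)); rewrite !E; split; lia.
- by exists i, (k - l), c, (2 * p - (k + l)); rewrite !E; split; lia.
- by exists j, (p + l - k), c, (p - (k + l)); rewrite !E; split; lia.
Qed.

Local Ltac check_twins :=
  rewrite /same_pos /pos_dist /path_len /=; split; lia.

(** By symmetry the first vertex is on the path of smaller number, which leaves
    the six pairs of paths (0,0), (0,1), (0,2), (1,1), (1,2) and (2,2). *)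
Lemma pos_dist_twin_long (p i k j l : nat) :
  2 <= p -> canonical p (p + 2) i k -> canonical p (p + 2) j l ->
  have_twins p (p + 2) i k j l.
Proof.
move=> hp.
wlog hij : i k j l / i <= j => [hw hk hl|].
  have [/hw|/ltnW/hw] := leqP i j; first exact.
  by case/(_ _ _ hl hk) => a [m [b [n [? ? ? ?]]]]; exists a, m, b, n.
rewrite /have_twins /canonical /path_len.
case: i hij => [|[|[|//]]]; case: j => [|[|[|//]]] // _ /=
  /andP[hk hik] /andP[hl hjl].
- have [?|?] := boolP ((k < p) && (l < p)).
    by exists 1, 1, 2, 1; check_twins.
  (* The neighbours of v on paths 1 and 2: path 2 has length p + 2. *)
  have [?|?] := boolP ((0 < k) && (0 < l)).
    by exists 1, (p - 1), 2, (p + 1); check_twins.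
  (* The two vertices are the ends u and v. *)
  by exists 0, 1, 1, 1; check_twins.
- have [?|?] := leqP k l; have [?|?|?] := ltngtP (k + l) p.
  + by exists 0, (p + k - l), 2, (p - (k + l)); check_twins.
  + by exists 1, (l - k), 2, (2 * p + 2 - (k + l)); check_twins.
  (* The vertices are opposite each other on the cycle of length 2p: the two
     neighbours of one of them are twins, unless the vertices are the ends. *)
  + by have [?|?] := posnP k;
      [exists 0, 1, 1, 1|exists 0, (k - 1), 0, (k + 1)]; check_twins.
  + by exists 1, (p + l - k), 2, (p - (k + l)); check_twins.
  + by exists 0, (k - l), 2, (2 * p + 2 - (k + l)); check_twins.
  + by have [?|?] := eqVneq k p;
      [exists 0, 1, 1, 1|exists 0, (k - 1), 0, (k + 1)]; check_twins.
- have [?|?] := boolP ((k == 0) || (k == p)).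
    by exists 0, 1, 1, 1; check_twins.
  have [?|?] := leqP (k + l) (p + 1); have [?|?] := leqP l k.
  + by exists 1, (p + 1 - (k + l)), 2, (p + l + 1 - k); check_twins.
  + by exists 0, (p + k + 1 - l), 1, (p + 1 - (k + l)); check_twins.
  + by exists 0, (k + 1 - l), 1, (2 * p + 1 - (k + l)); check_twins.
  + have [?|?] := eqVneq l (k + 1).
      by exists 0, 0, 1, (2 * p + 1 - (k + l)); check_twins.
    by exists 1, (2 * p + 1 - (k + l)), 2, (l - (k + 1)); check_twins.
- by exists 0, 1, 2, 1; check_twins.
- have [?|?] := boolP ((k == 0) || (k == p)).
    by exists 0, 1, 1, 1; check_twins.
  have [?|?] := leqP (k + l) (p + 1); have [?|?] := leqP l k.
  + by exists 0, (p + 1 - (k + l)), 2, (p + l + 1 - k); check_twins.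
  + by exists 1, (p + k + 1 - l), 0, (p + 1 - (k + l)); check_twins.
  + by exists 1, (k + 1 - l), 0, (2 * p + 1 - (k + l)); check_twins.
  + have [?|?] := eqVneq l (k + 1).
      by exists 1, 0, 0, (2 * p + 1 - (k + l)); check_twins.
    by exists 0, (2 * p + 1 - (k + l)), 2, (l - (k + 1)); check_twins.
- by exists 0, 1, 1, 1; check_twins.
Qed.

Lemma pos_dist_twins (p r i k j l : nat) :
  2 <= p -> r = p \/ r = p + 2 -> canonical p r i k -> canonical p r j l ->
  have_twins p r i k j l.
Proof.
by move=> hp [] -> hk hl; [apply: pos_dist_twin_eq|apply: pos_dist_twin_long].
Qed.

(** * Graph distance and metric dimension *)

Lemma bigminn_leP (I : finType) (P : pred I) (F : I -> nat) (m n : nat) :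
  reflect (n <= m /\ forall i, P i -> n <= F i)
          (n <= \big[minn/m]_(i | P i) F i).
Proof. by rewrite -minEnat; apply: (@Order.TotalTheory.bigmin_geP _ nat). Qed.

Lemma bigminn_inf (I : finType) (P : pred I) (F : I -> nat) (m n : nat) i :
  P i -> F i <= n -> \big[minn/m]_(i | P i) F i <= n.
Proof. by rewrite -minEnat; apply: (@Order.TotalTheory.bigmin_inf _ nat). Qed.

Lemma bigminn_le_id (I : finType) (P : pred I) (F : I -> nat) (m : nat) :
  \big[minn/m]_(i | P i) F i <= m.
Proof. by rewrite -minEnat; apply: (@Order.TotalTheory.bigmin_le_id _ nat). Qed.

(** A function that vanishes at [s], grows by at most 1 along an edge and has,
    at every vertex other than [s], a neighbour with value one less is the distance
    from [s]. *)
Lemma dist_unique (G : sgraph) (s : G) (f : G -> nat) :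
  f s = 0 ->
  (forall x y : G, adj x y -> f y <= (f x).+1) ->
  (forall x : G, x = s \/ exists2 y : G, adj y x & f x = (f y).+1) ->
  forall x, dist s x = f x.
Proof.
move=> fs0 f_lip f_desc x.
have f_path y t : path (@adj G) y t -> f (last y t) <= f y + size t.
  elim: t y => [|z t IH] y /=; first by rewrite addn0.
  by case/andP=> /f_lip yz /IH; lia.
have [t [st lt szt]] :
    exists t, [/\ path (@adj G) s t, last s t = x & size t = f x].
  move fx: (f x) => n; elim: n x fx => [|n IH] x fx.
    by have [->|[y _]] := f_desc x; [exists [::]|rewrite fx].
  have [xs|[y yx]] := f_desc x; first by move: fx; rewrite xs fs0.
  rewrite fx => -[/esym/IH[t [st lt szt]]].
  by exists (rcons t x); rewrite rcons_path last_rcons size_rcons st lt szt.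
have [t' [st' lt' ut' szt']] :
    exists t', [/\ path (@adj G) s t', last s t' = x, uniq (s :: t')
                 & size t' = f x].
  case/shortenP: st lt => t' st' ut' subt' lt'; exists t'; split=> //.
  apply/eqP; rewrite eqn_leq -{1}szt uniq_leq_size //=; last by case/andP: ut'.
  by have := f_path _ _ st'; rewrite lt' fs0.
have ltfx : f x < #|G|.
  by rewrite -szt' -[_.+1]/(size (s :: t')) -(card_uniqP ut') max_card.
apply/eqP; rewrite eqn_leq; apply/andP; split.
  apply: (@bigminn_inf _ _ _ _ _ (Ordinal ltfx)) => //=.
  apply/existsP; exists (Tuple (introT eqP szt')) => /=.
  by rewrite st' lt' eqxx.
apply/bigminn_leP; split=> [|n /existsP[w /and3P[sw /eqP <- _]]].
  exact: ltnW.
by have := f_path _ _ sw; rewrite fs0 size_tuple.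
Qed.

Lemma metric_dim_eq (G : sgraph) (n : nat) :
  (exists2 S : {set G}, vertex_metric_generator S & #|S| <= n) ->
  n <= #|G| ->
  (forall S : {set G}, vertex_metric_generator S -> n <= #|S|) ->
  metric_dim G = n.
Proof.
move=> [S genS leS] leG lb; apply/eqP; rewrite eqn_leq.
by rewrite (bigminn_inf _ genS leS); apply/bigminn_leP.
Qed.

(** * Invariance under isomorphism *)

Lemma isomorphic_sym (G H : sgraph) : isomorphic G H -> isomorphic H G.
Proof.
move=> [f [g fK gK] fE]; exists g; first by exists f.
by move=> x y; rewrite -fE !gK.
Qed.

Lemma isomorphic_card (G H : sgraph) : isomorphic G H -> #|G| = #|H|.
Proof. by case=> f /bij_eq_card. Qed.

Lemma dist_iso (G H : sgraph) (f : G -> H) :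
  bijective f -> (forall x y, adj (f x) (f y) = adj x y) ->
  forall x y, dist (f x) (f y) = dist x y.
Proof.
move=> bij_f fE x y; have inj_f := bij_inj bij_f.
have pathE (z : G) t : path (@adj H) (f z) (map f t) = path (@adj G) z t.
  by rewrite path_map; apply: eq_path => a b; apply: fE.
rewrite /dist -(bij_eq_card bij_f); apply: eq_bigl => n.
case: bij_f => g fK gK.
apply/existsP/existsP => -[t /and3P[st lt ut]]; last first.
  exists [tuple of map f t]; rewrite /= pathE st last_map (inj_eq inj_f) lt /=.
  by rewrite (mem_map inj_f) (map_inj_uniq inj_f).
exists [tuple of map g t].
have tE : val t = map f (map g t) by rewrite -map_comp map_id_in // => ? _ /=.
rewrite tE pathE in st; rewrite tE last_map (inj_eq inj_f) in lt.
by rewrite tE -map_cons (map_inj_uniq inj_f) in ut; rewrite st lt ut.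
Qed.

Lemma metric_dim_iso (G H : sgraph) :
  isomorphic G H -> metric_dim G = metric_dim H.
Proof.
have le_dim (K L : sgraph) : isomorphic K L -> metric_dim K <= metric_dim L.
  move=> iso; have := isomorphic_card iso; case: iso => f bij_f fE cardE.
  have [g fK gK] := bij_f.
  apply/bigminn_leP; split=> [|S /forallP genS].
    by rewrite -cardE bigminn_le_id.
  apply: (@bigminn_inf _ _ _ _ _ (f @^-1: S)); last first.
    by rewrite on_card_preimset //; apply: onW_bij.
  apply/forallP => x; apply/forallP => y; apply/implyP => xy.
  have /forallP/(_ (f y)) := genS (f x).
  rewrite (bij_eq bij_f) xy => /exists_inP[s sS d].
  apply/exists_inP; exists (g s); first by rewrite inE gK.
  by rewrite /distinguishes -!(dist_iso bij_f fE) gK.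
move=> iso; apply/eqP; rewrite eqn_leq !le_dim //; exact: isomorphic_sym.
Qed.

Lemma cyclomatic_iso (G H : sgraph) :
  isomorphic G H -> cyclomatic G = cyclomatic H.
Proof.
move=> iso; rewrite /cyclomatic (isomorphic_card iso).
case: iso => f bij_f fE; have inj_f := bij_inj bij_f; have [g fK gK] := bij_f.
have -> // : #|edges G| = #|edges H|.
rewrite -(card_imset (mem (edges G)) (imset_inj inj_f)); congr #|pred_of_set _|.
apply/setP => e; apply/imsetP/imsetP => [[_ /imsetP[[x y] xy ->] ->]|].
  rewrite inE /= in xy; exists (f x, f y); first by rewrite inE /= fE.
  by rewrite /= imsetU !imset_set1.
case=> -[x y]; rewrite inE /= => xy ->; exists [set g x; g y]; last first.
  by rewrite imsetU !imset_set1 !gK.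
by apply/imsetP; exists (g x, g y); rewrite //= inE /= -fE !gK.
Qed.

(** * Sets with at most two elements *)

Lemma set2_eq (U : finType) (a b c d : U) :
  [set a; b] = [set c; d] -> (a == c) && (b == d) || (a == d) && (b == c).
Proof.
move/setP=> E; have := E a; have := E b; have := E c; have := E d.
rewrite !inE !eqxx ?orbT (eq_sym c) (eq_sym d) (eq_sym c) (eq_sym d).
by do 4!case: (_ == _).
Qed.

Lemma set_card_le2 (U : finType) (x0 : U) (S : {set U}) :
  #|S| <= 2 -> exists s t, S \subset [set s; t].
Proof.
move=> le2; exists (nth x0 (enum S) 0), (nth x0 (enum S) 1).
apply/subsetP => x; rewrite -mem_enum; rewrite cardE in le2.
by case: (enum S) le2 => [|a [|b [|]]] //= _; rewrite !inE // => ->.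
Qed.

(** * Coordinates and distances in a theta graph *)

Section ThetaGraph.
Variables p r : nat.
Hypothesis p_ge2 : 2 <= p.
Hypothesis r_eq : r = p \/ r = p + 2.

Local Notation len := (path_len p r).
Local Notation T := (Theta p p r).
Local Notation pos := (@theta_pos p p r).

Lemma theta_lengthE (i : 'I_3) : theta_length p p r i = len i.
Proof. by case: i => [[|[|[|]]]]. Qed.

Lemma theta_index_lt (i : 'I_3) (j : 'I_(theta_length p p r i).-1) :
  j < (len i).-1.
Proof. by rewrite -theta_lengthE. Qed.

(** The path number and the position of a vertex; the ends [u] and [v] are taken
    on path 0. *)
Definition coord (x : T) : nat * nat :=
  match x with
  | inl b => (0, if b then p else 0)
  | inr t => (val (tag t), (val (tagged t)).+1)
  end.

Lemma coord_pos (i : 'I_3) (k : nat) : k <= len i ->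
  coord (pos i k) =
  if k == 0 then (0, 0) else if k == len i then (0, p) else (nat_of_ord i, k).
Proof.
case: k => //= k lek; case: insubP => [j _ jk|] /=.
  have := theta_index_lt j; rewrite jk => ltk.
  by case: eqP => //; lia.
by rewrite theta_lengthE; case: eqP => //; lia.
Qed.

Lemma pos_end (i : 'I_3) : pos i (len i) = inl true.
Proof.
have len_gt0 : 0 < len i by rewrite /path_len; case: ifP => _; lia.
move E: (len i) len_gt0 => [//|n] _ /=.
by rewrite insubF // theta_lengthE E ltnn.
Qed.

Lemma coord_canonical (x : T) :
  canonical p r (coord x).1 (coord x).2 /\
  exists i : 'I_3, val i = (coord x).1 /\ x = pos i (coord x).2.
Proof.
case: x => [[]|[i j]] /=.
- split; first by rewrite /canonical /path_len /= leqnn.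
  by exists ord0; rewrite -(pos_end ord0).
- split; first by rewrite /canonical /path_len.
  by exists ord0.
have ltj := theta_index_lt j.
split; first by have := ltn_ord i; rewrite /canonical; lia.
by exists i; rewrite /= valK.
Qed.

Lemma coord_inj : injective coord.
Proof.
move=> x y xy; have [_ [i [ix xE]]] := coord_canonical x.
have [_ [j [jy yE]]] := coord_canonical y.
by rewrite xE yE xy (_ : i = j) //; apply: val_inj; rewrite ix jy xy.
Qed.

Lemma pos_eqE (i j : 'I_3) (k l : nat) : k <= len i -> l <= len j ->
  (pos i k == pos j l) = same_pos p r i k j l.
Proof.
move=> hk hl; rewrite -(inj_eq coord_inj) !coord_pos // /same_pos.
have hi := ltn_ord i; have hj := ltn_ord j; move: hi hj hk hl.
rewrite /path_len; move: (nat_of_ord i) (nat_of_ord j) => {}i {}j.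
case: i => [|[|[|]]] //=; case: j => [|[|[|]]] //= _ _ hk hl;
  by do ?case: ifP => ?; rewrite xpair_eqE; lia.
Qed.

Lemma theta_adjP (x y : T) :
  reflect (exists i : 'I_3, exists2 k, k < len i &
             x = pos i k /\ y = pos i k.+1 \/ y = pos i k /\ x = pos i k.+1)
          (adj x y).
Proof.
apply: (iffP existsP) => [[i /existsP[k b]]|[i [k ltk xy]]]; exists i.
  exists k; first by rewrite -theta_lengthE.
  by case/orP: b => /andP[/eqP -> /eqP ->]; [left|right].
rewrite -theta_lengthE in ltk; apply/existsP; exists (Ordinal ltk) => /=.
by case: xy => -[-> ->]; rewrite !eqxx ?orbT.
Qed.

Lemma theta_adj_pos (i : 'I_3) (k : nat) :
  k < len i -> adj (pos i k : T) (pos i k.+1).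
Proof. by move=> ltk; apply/theta_adjP; exists i, k => //; left. Qed.

(** The distance formula does not depend on the path on which an end is taken. *)
Lemma pos_dist_coord (i j k l : nat) :
  j < 3 -> canonical p r i k -> l <= len j ->
  pos_dist p r i k j l =
  if l == 0 then pos_dist p r i k 0 0
  else if l == len j then pos_dist p r i k 0 p else pos_dist p r i k j l.
Proof.
rewrite /canonical /pos_dist /path_len.
case: i => [|[|[|]]] //=; case: j => [|[|[|]]] //= _;
  do ?case: ifP => ?; lia.
Qed.

(** [pos_dist] as a function of two vertices. *)
Definition theta_dist (x y : T) : nat :=
  pos_dist p r (coord x).1 (coord x).2 (coord y).1 (coord y).2.

Lemma theta_dist_pos (x : T) (j : 'I_3) (l : nat) : l <= len j ->
  theta_dist x (pos j l) = pos_dist p r (coord x).1 (coord x).2 j l.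
Proof.
move=> hl; have [can_x _] := coord_canonical x.
rewrite [RHS](pos_dist_coord (ltn_ord j) can_x hl) /theta_dist coord_pos //.
by case: ifP => // _; case: ifP.
Qed.

Lemma pos_dist_lip (i k j l : nat) : canonical p r i k -> j < 3 -> l < len j ->
  pos_dist p r i k j l <= (pos_dist p r i k j l.+1).+1 /\
  pos_dist p r i k j l.+1 <= (pos_dist p r i k j l).+1.
Proof.
rewrite /canonical /pos_dist /path_len => hik hj hl.
by case: (i == j); lia.
Qed.

(** From any other position some neighbouring position is one step nearer to the
    given one.  The index [a] allows the neighbour of an end to be sought on
    another path. *)
Lemma pos_dist_desc (i k j l : nat) : canonical p r i k -> canonical p r j l ->
  same_pos p r i k j l \/
  exists a m n, [/\ [&& a < 3, m <= len a & n <= len a],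
     (m == n.+1) || (n == m.+1), same_pos p r a m j l
   & pos_dist p r i k j l = (pos_dist p r i k a n).+1].
Proof.
rewrite /canonical => /and3P[hi hk hik] /and3P[hj hl hjl].
have [?|neq] := boolP (same_pos p r i k j l); [by left|right].
have [hij|hij] := eqVneq i j.
  subst j; exists i, l, (if l < k then l.+1 else l.-1).
  by case: ifP => hlk; split; move: neq; rewrite /same_pos /pos_dist !eqxx; lia.
have Eij := negbTE hij.
have [h0|h0] := posnP l.
  exists i, 0, 1; move: neq hi hj hk hik hl hjl hij.
  rewrite /pos_dist Eij eqxx /same_pos h0 /path_len.
  by case: r_eq => ->; case: i {Eij} => [|[|[|]]] //=;
    case: j => [|[|[|]]] //= *; split; lia.
have [h1|h1] := eqVneq l (len j); last first.
  exists j, l, (if k + l <= len i + len j - (k + l) then l.-1 else l.+1).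
  rewrite /pos_dist Eij /same_pos eqxx.
  by case: ifP => hlk; split; lia.
exists i, (len i), (len i).-1; move: h1 neq hi hj hk hik hl hjl hij.
rewrite /pos_dist Eij eqxx /same_pos /path_len.
by case: r_eq => ->; case: i {Eij} => [|[|[|]]] //=;
  case: j => [|[|[|]]] //= *; split; lia.
Qed.

Lemma theta_distE (x y : T) : dist x y = theta_dist x y.
Proof.
have [can_x [i [ix xE]]] := coord_canonical x.
apply: dist_unique y => [|y z /theta_adjP[j [l ltl yz]]|y].
- by rewrite /theta_dist /pos_dist eqxx subnn.
- have [? ?] := pos_dist_lip can_x (ltn_ord j) ltl.
  by case: yz => -[-> ->]; rewrite !theta_dist_pos // ltnW.
have [can_y [j [jy yE]]] := coord_canonical y.
have lex : (coord x).2 <= len i by rewrite ix; case/and3P: can_x.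
have ley : (coord y).2 <= len j by rewrite jy; case/and3P: can_y.
have [same|[a [m [n [/and3P[ha hm hn] mn same d]]]]] :=
  pos_dist_desc can_x can_y.
  by left; apply/eqP; rewrite xE yE eq_sym pos_eqE // ix jy.
right; exists (pos (Ordinal ha) n); last by rewrite theta_dist_pos.
have -> : y = pos (Ordinal ha) m by apply/eqP; rewrite yE eq_sym pos_eqE // jy.
case/orP: mn => /eqP mn; subst; last by rewrite adj_sym theta_adj_pos.
by apply: theta_adj_pos.
Qed.

(** * Cyclomatic number and metric dimension of a theta graph *)

Lemma card_theta : #|T| = 2 * p + r - 1.
Proof.
rewrite card_sum card_bool card_tagged sumnE big_map big_enum /=.
rewrite !big_ord_recl big_ord0 !card_ord !theta_lengthE /path_len /=; lia.
Qed.

Lemma card_edges_theta : #|edges T| = 2 * p + r.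
Proof.
(* An edge is named by its path and by the position at which it starts. *)
pose E := {i : 'I_3 & 'I_(len i)}.
pose edge (e : E) : {set T} :=
  [set pos (tag e) (tagged e); pos (tag e) (tagged e).+1].
have edge_inj : injective edge.
  move=> [i k] [j l] /set2_eq E2.
  have ltk := ltn_ord k; have ltl := ltn_ord l.
  have lek := ltnW ltk; have lel := ltnW ltl.
  rewrite (pos_eqE lek lel) (pos_eqE ltk ltl) (pos_eqE lek ltl) in E2.
  rewrite (pos_eqE ltk lel) /same_pos in E2.
  have [ij kl] : i = j :> nat /\ k = l :> nat.
    move: E2 ltk ltl {lek lel}; move: (nat_of_ord k) (nat_of_ord l) => k' l'.
    rewrite /path_len.
    by do 2!case: ifP => _; split; lia.
  move/val_inj: ij => ij; subst j.
  by move/val_inj: kl => ->.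
have -> : edges T = edge @: [set: E].
  apply/setP=> e; apply/imsetP/imsetP.
    case=> -[x y]; rewrite inE /= => /theta_adjP[i [k ltk xy]] ->.
    exists (Tagged (fun i : 'I_3 => 'I_(len i)) (Ordinal ltk)).
      by rewrite inE.
    by case: xy => -[-> ->]; rewrite /edge //= setUC.
  case=> -[i k] _ ->; exists (pos i k, pos i k.+1) => //.
  by rewrite inE; apply: theta_adj_pos.
rewrite card_imset // cardsT card_tagged sumnE big_map big_enum /=.
rewrite !big_ord_recl big_ord0 !card_ord /path_len /=; lia.
Qed.

Lemma cyclomatic_theta : cyclomatic T = 2%:Z%R.
Proof. by rewrite /cyclomatic card_edges_theta card_theta; lia. Qed.

Lemma no_small_generator (s t : T) (S : {set T}) :
  S \subset [set s; t] -> ~~ vertex_metric_generator S.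
Proof.
move=> sub; have [can_s _] := coord_canonical s.
have [can_t _] := coord_canonical t.
have [a [m [b [n [/and4P[ha hm hb hn] neq ds dt]]]]] :=
  pos_dist_twins p_ge2 r_eq can_s can_t.
apply/forallPn; exists (pos (Ordinal ha) m).
apply/forallPn; exists (pos (Ordinal hb) n).
rewrite negb_imply pos_eqE // neq /=; apply/exists_inPn => z /(subsetP sub).
by case/set2P => ->;
  rewrite /distinguishes !theta_distE !theta_dist_pos ?ds ?dt ?eqxx.
Qed.

(** The distances to [u] and to its neighbours on paths 0 and 1 determine a
    vertex. *)
Lemma pos_dist_separates (i k j l : nat) :
  canonical p r i k -> canonical p r j l ->
  pos_dist p r 0 0 i k = pos_dist p r 0 0 j l ->
  pos_dist p r 0 1 i k = pos_dist p r 0 1 j l ->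
  pos_dist p r 1 1 i k = pos_dist p r 1 1 j l -> (i, k) = (j, l).
Proof.
rewrite /canonical /pos_dist /path_len.
case: i => [|[|[|]]] //=; case: j => [|[|[|]]] //= *; congr pair; lia.
Qed.

Lemma metric_dim_theta : metric_dim T = 3.
Proof.
apply: metric_dim_eq; last 2 first.
- by rewrite card_theta; lia.
- move=> S genS; rewrite ltnNge; apply/negP.
  case/(set_card_le2 (inl false : T)) => s [t].
  by move/no_small_generator; rewrite genS.
pose A : 'I_3 := inord 0; pose B : 'I_3 := inord 1.
exists [set pos A 0; pos A 1; pos B 1]; last first.
  by rewrite -setUA !cardsU1 cards1; do !case: (_ \notin _).
apply/forallP => x; apply/forallP => y; apply/implyP => xy.
rewrite -[[exists s in _, _]]negbK; apply: contra xy => /exists_inPn same.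
have [can_x _] := coord_canonical x.
have [can_y _] := coord_canonical y.
have hA : A = 0 :> nat by rewrite inordK.
have hB : B = 1 :> nat by rewrite inordK.
have lA : len A = p by rewrite hA.
have lB : len B = p by rewrite hB.
rewrite -(inj_eq coord_inj) [coord x]surjective_pairing.
rewrite [coord y]surjective_pairing.
apply/eqP; apply: (pos_dist_separates can_x can_y).
- have := same (pos A 0); rewrite !inE eqxx => /(_ isT).
  rewrite /distinguishes !theta_distE negbK => /eqP.
  by rewrite /theta_dist coord_pos.
- have := same (pos A 1); rewrite !inE eqxx orbT => /(_ isT).
  rewrite /distinguishes !theta_distE negbK => /eqP.
  by rewrite /theta_dist coord_pos /= ?lA ?hA; [case: eqP => //; lia|lia].
- have := same (pos B 1); rewrite !inE eqxx !orbT => /(_ isT).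
  rewrite /distinguishes !theta_distE negbK => /eqP.
  by rewrite /theta_dist coord_pos /= ?lB ?hB; [case: eqP => //; lia|lia].
Qed.

End ThetaGraph.

Theorem corollary9 (p : nat) (hp : 2 <= p) (G : sgraph)
  (hG : isomorphic G (Theta p p p) \/ isomorphic G (Theta p p (p + 2))) :
  ((metric_dim G)%:Z = 2 * cyclomatic G - 1)%R.
Proof.
by case: hG => iso; rewrite (metric_dim_iso iso) (cyclomatic_iso iso);
  rewrite metric_dim_theta ?cyclomatic_theta //; auto.
Qed.
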